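(* Let $P=[a_1,a_2,a_3,a_4]$ be a quadrilateral in the plane $\mathbb{C}$ with vertices $a_1,a_2,a_3,a_4$, and for each $i\in\{1,2,3,4\}$ let $\alpha_i$ be half of the (interior) angle of $P$ at the vertex $a_i$. For $\{i,j,k,l\}=\{1,2,3,4\}$, let $b_{ijkl}$ be the fixed point of the composition of rotations $r_{a_i,\alpha_i}r_{a_j,\alpha_j}r_{a_k,\alpha_k}r_{a_l,\alpha_l}$. Then each of the following is a parallelogram: \begin{align*} P^e&:=[b_{1234},b_{1243},b_{2143},b_{2134}],\\ P^{(13)(24)}&:=[b_{3412},b_{3421},b_{4321},b_{4312}],\\ P^{(23)}&:=[b_{1324},b_{1342},b_{3142},b_{3124}],\\ P^{(1342)}&:=[b_{2413},b_{2431},b_{4231},b_{4213}],\\ P^{(24)}&:=[b_{1432},b_{1423},b_{4123},b_{4132}],\\ P^{(13)}&:=[b_{3214},b_{3241},b_{2341},b_{2314}]. \end{align*} Moreover, $P^e$ is congruent to $P^{(13)(24)}$, $P^{(23)}$ is congruent to $P^{(1342)}$, and $P^{(24)}$ is congruent to $P^{(13)}$.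
   Context: The plane $\mathbb{R}^2$ is identified with $\mathbb{C}$, and $i$ in exponents $e^{i\alpha}$ denotes the imaginary unit. For $a\in\mathbb{C}$ and $\alpha\in\mathbb{R}$, $r_{a,\alpha}:\mathbb{C}\to\mathbb{C}$, $z\mapsto e^{i\alpha}(z-a)+a$, is the rotation about $a$ by angle $\alpha$. Juxtaposition of maps denotes composition, with the rightmost map applied first. $[p_1,p_2,p_3,p_4]$ denotes the quadrilateral with vertices $p_1,p_2,p_3,p_4$ and edges $p_1p_2,\ p_2p_3,\ p_3p_4,\ p_4p_1$ (so the symbols may be circularly permuted or reversed in order). The given quadrilateral $P$ is an ordinary simple (non-self-intersecting) quadrilateral, whose interior angles sum to $2\pi$, so that $\alpha_1+\alpha_2+\alpha_3+\alpha_4=\pi$. Hence for $\{i,j,k,l\}=\{1,2,3,4\}$ the composition $r_{a_i,\alpha_i}r_{a_j,\alpha_j}r_{a_k,\alpha_k}r_{a_l,\alpha_l}$ is a rotation by angle $\pi$ and has a unique fixed point, so $b_{ijkl}$ is well defined. In the conclusion, ''$[p_1,p_2,p_3,p_4]$ is a parallelogram'' means $p_1-p_2=p_4-p_3$ (equality of the vectors of opposite edges; degenerate, i.e. collinear, parallelograms are allowed). Two such parallelograms are congruent if an isometry of the plane carries one onto the other (vertices to vertices, edges to edges). *)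

(* Defs.v *)
From Stdlib Require Import Reals ClassicalEpsilon.
From Coquelicot Require Import Coquelicot.

Local Open Scope R_scope.

Inductive vertex : Set := v1 | v2 | v3 | v4.

Definition next (i : vertex) : vertex :=
  match i with v1 => v2 | v2 => v3 | v3 => v4 | v4 => v1 end.

(* A quadrilateral is given by its vertices in cyclic order;
   its edges join [p i] to [p (next i)]. *)
Definition quadrilateral : Type := vertex -> C.

Definition quad (p1 p2 p3 p4 : C) : quadrilateral :=
  fun i => match i with v1 => p1 | v2 => p2 | v3 => p3 | v4 => p4 end.

Definition segment (p q z : C) : Prop :=
  exists t : R, 0 <= t <= 1 /\ z = (p + RtoC t * (q - p))%C.

Definition edge (P : quadrilateral) (i : vertex) (z : C) : Prop :=
  segment (P i) (P (next i)) z.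

(* Consecutive edges share only their common vertex and opposite edges are
   disjoint.  This already forces the four vertices to be distinct. *)
Definition simple_quadrilateral (P : quadrilateral) : Prop :=
  forall (i : vertex) (z : C),
    (edge P i z -> edge P (next i) z -> z = P (next i)) /\
    (edge P i z -> ~ edge P (next (next i)) z).

Definition boundary (P : quadrilateral) (z : C) : Prop :=
  exists i : vertex, edge P i z.

(* The path is defined on all of R, which is no restriction: a path on [0, 1]
   extends continuously by constants. *)
Definition joined_off_boundary (P : quadrilateral) (z w : C) : Prop :=
  exists g : R -> C,
    (forall t : R, continuous g t) /\ g 0 = z /\ g 1 = w /\
    (forall t : R, 0 <= t <= 1 -> ~ boundary P (g t)).

(* The interior is the union of the bounded (path) components of the complement
   of the boundary; for a simple quadrilateral there is exactly one. *)
Definition interior_region (P : quadrilateral) (z : C) : Prop :=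
  ~ boundary P z /\
  exists M : R, forall w : C, joined_off_boundary P z w -> Cmod w <= M.

(* e^{i t} *)
Definition expi (t : R) : C := (cos t, sin t).

(* Near the vertex [P i], the interior of [P] is an open circular sector of
   opening [theta], swept counterclockwise from the direction [phi]. *)
Definition is_interior_angle (P : quadrilateral) (i : vertex) (theta : R) : Prop :=
  0 < theta < 2 * PI /\
  exists phi eps : R, 0 < eps /\
    forall r t : R, 0 < r < eps -> 0 <= t < 2 * PI ->
      (interior_region P (P i + RtoC r * expi (phi + t))%C <-> 0 < t < theta).

Definition rotation (a : C) (alpha : R) (z : C) : C :=
  (expi alpha * (z - a) + a)%C.

(* The fixed point of [f]; meaningful when [f] has exactly one. *)
Definition fixed_point (f : C -> C) : C :=
  epsilon (inhabits (RtoC 0)) (fun z => f z = z).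

Definition rotation_fixed_point (a : quadrilateral) (alpha : vertex -> R)
    (i j k l : vertex) : C :=
  fixed_point (fun z =>
    rotation (a i) (alpha i) (rotation (a j) (alpha j)
      (rotation (a k) (alpha k) (rotation (a l) (alpha l) z)))).

(* Degenerate (collinear) parallelograms are allowed. *)
Definition parallelogram (P : quadrilateral) : Prop :=
  (P v1 - P v2 = P v4 - P v3)%C.

Definition isometry (f : C -> C) : Prop :=
  forall z w : C, Cmod (f z - f w)%C = Cmod (z - w)%C.

(* The relabelings of the vertices that carry edges to edges: they preserve or
   reverse the cyclic order, and so are automatically bijective. *)
Definition cyclic_relabeling (s : vertex -> vertex) : Prop :=
  (forall i : vertex, s (next i) = next (s i)) \/
  (forall i : vertex, next (s (next i)) = s i).

Definition congruent (P Q : quadrilateral) : Prop :=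
  exists (f : C -> C) (s : vertex -> vertex),
    isometry f /\ cyclic_relabeling s /\ forall i : vertex, f (P i) = Q (s i).

(* Main.v *)
Require Import Defs.
From Stdlib Require Import ZArith Reals Lra Lia Classical ClassicalEpsilon.
From Coquelicot Require Import Coquelicot.

(** Write [w_i = expi (alpha i)].  Everything rests on the identity
    [w_1 w_2 w_3 w_4 = -1].  Once it is known, the composition of the four
    rotations, in any order, has the form [z |-> c - z], and its fixed point is
    [c / 2] for an explicit [c] ([rotation_fixed_point_eq]).  Subtracting such
    formulas, exchanging the two rotations [k, l] that are applied first moves
    the fixed point by [w_i w_j x], and exchanging the two that are applied last
    moves it by [y], where [x] depends only on [{k, l}] up to sign and [y] only
    on [{i, j}].  Hence the four points form a parallelogram with side vectors
    [w_i w_j x] and [y]; with [(i, j)] and [(k, l)] exchanged, the side vectors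
    are [w_k w_l y] and [x].  Multiplication by [w_k w_l] carries
    [w_i w_j x] and [y] to [- x] and [w_k w_l y], which gives the congruence
    ([swapped_quad_congruent]).

    The identity says that the interior angles add up to [2 PI] modulo [4 PI].
    It is proved without the Jordan curve theorem, in two steps.

    First, at each vertex the two edges cut a small circle into two open arcs,
    and each of these arcs lies in one component of the complement of the
    boundary.  An interior angle, being less than [2 PI], can therefore only be
    one of the two arcs: it is the angle [beta_i] to the left of the path
    [a_1 a_2 a_3 a_4], or [2 PI - beta_i].  A segment close and parallel to an
    edge does not meet the boundary, so that the choice is the same at both
    ends of the edge, hence at all vertices
    ([interior_angles_on_same_side]).  Whether the interior is on the left or on
    the right is irrelevant, since [sum (2 PI - beta_i) = 8 PI - sum beta_i].

    Secondly, [sum beta_i] is [2 PI] or [6 PI], according to the orientation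
    ([left_angle_sum]).  The value to be excluded is [4 PI], that of a figure
    eight.  In a simple quadrilateral two opposite vertices have turns of the
    same strict sign, for otherwise two opposite edges would meet, or
    all turns would vanish and the path could not close up
    ([opposite_turns_agree]).  The diagonal joining the other two vertices
    separates these two, so the directions of the edges lie in known half-planes
    relative to the diagonal, and the angles can be added
    ([angle_sum_from_turns]). *)

Local Open Scope R_scope.

(** * Angles *)

Lemma expi_plus (x y : R) : expi (x + y) = (expi x * expi y)%C.
Proof.
  unfold expi, Cmult; simpl.
  rewrite cos_plus, sin_plus.
  f_equal; ring.
Qed.

Lemma Cmod_expi (t : R) : Cmod (expi t) = 1.
Proof.
  unfold expi, Cmod; simpl.
  replace (cos t * (cos t * 1) + sin t * (sin t * 1)) with 1
    by (generalize (sin2_cos2 t); unfold Rsqr; lra).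
  apply sqrt_1.
Qed.

Lemma expi_PI : expi PI = (- (1))%C.
Proof.
  unfold expi; rewrite cos_PI, sin_PI.
  unfold Copp, RtoC; simpl; f_equal; ring.
Qed.

Lemma expi_neq_0 (t : R) : expi t <> 0%C.
Proof. apply Cmod_gt_0; rewrite Cmod_expi; lra. Qed.

Lemma expi_add_IZR_period (x : R) (n : Z) : expi (x + 2 * PI * IZR n) = expi x.
Proof.
  assert (Hn : forall (y : R) (m : nat), expi (y + 2 * PI * INR m) = expi y).
  { intros y m; unfold expi.
    replace (2 * PI * INR m) with (2 * INR m * PI) by ring.
    now rewrite cos_period, sin_period. }
  destruct (Z.le_ge_cases 0 n) as [H | H].
  - rewrite <- (Z2Nat.id n H), <- INR_IZR_INZ; apply Hn.
  - rewrite <- (Hn _ (Z.to_nat (- n))), INR_IZR_INZ, Z2Nat.id by lia.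
    rewrite opp_IZR; f_equal; ring.
Qed.

Lemma expi_inj (x y : R) : Rabs (x - y) < 2 * PI -> expi x = expi y -> x = y.
Proof.
  intros Hxy H; unfold expi in H; injection H as Hc Hs.
  assert (Hsin : sin ((x - y) / 2) = 0).
  { assert (H1 : cos (x - y) = 1)
      by (rewrite cos_minus, Hc, Hs; generalize (sin2_cos2 y); unfold Rsqr; lra).
    replace (x - y) with (2 * ((x - y) / 2)) in H1 by field.
    rewrite cos_2a_sin in H1; nra. }
  apply Rabs_def2 in Hxy.
  destruct (Rtotal_order (x - y) 0) as [Hlt | [Heq | Hgt]]; [| lra |].
  - assert (Hp : 0 < sin (- ((x - y) / 2))) by (apply sin_gt_0; lra).
    rewrite sin_neg in Hp; lra.
  - assert (Hp : 0 < sin ((x - y) / 2)) by (apply sin_gt_0; lra).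
    lra.
Qed.

(** The representative of an angle in [[0, 2 * PI)]. *)
Definition reduce (x : R) : R := x - 2 * PI * IZR (Int_part (x / (2 * PI))).

Lemma expi_reduce (x : R) : expi (reduce x) = expi x.
Proof.
  unfold reduce.
  rewrite <- (expi_add_IZR_period x (- Int_part (x / (2 * PI)))), opp_IZR.
  f_equal; ring.
Qed.

Lemma reduce_bounds (x : R) : 0 <= reduce x < 2 * PI.
Proof.
  unfold reduce; generalize PI_RGT_0; intros HPI.
  destruct (base_Int_part (x / (2 * PI))) as [H1 H2].
  replace x with (2 * PI * (x / (2 * PI))) at 1 3 by (field; lra).
  nra.
Qed.

Lemma reduce_unique (x y : R) : 0 <= x < 2 * PI -> expi x = expi y -> reduce y = x.
Proof.
  intros Hx H; generalize (reduce_bounds y); intros Hy.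
  apply expi_inj; [apply Rabs_def1; lra |].
  now rewrite expi_reduce.
Qed.

Lemma polar_form (z : C) : exists t : R, z = (RtoC (Cmod z) * expi t)%C.
Proof.
  destruct (Req_dec (Cmod z) 0) as [H0 | H0].
  { exists 0; rewrite (Cmod_eq_0 z H0), Cmod_0; ring. }
  set (m := Cmod z) in *.
  assert (Hm : 0 < m) by (generalize (Cmod_ge_0 z); fold m; lra).
  destruct z as [x y].
  assert (Hsq : x * x + y * y = m * m).
  { unfold m, Cmod; simpl fst; simpl snd.
    rewrite sqrt_sqrt; nra. }
  assert (Hx : -1 <= x / m <= 1).
  { split; [apply Rle_div_r | apply Rle_div_l]; nra. }
  assert (Hs : sin (acos (x / m)) = Rabs y / m).
  { rewrite sin_acos by exact Hx.
    replace (1 - Rsqr (x / m)) with (Rsqr (y / m))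
      by (unfold Rsqr; field_simplify_eq; nra).
    rewrite sqrt_Rsqr_abs; unfold Rdiv.
    rewrite Rabs_mult, (Rabs_pos_eq (/ m)); [reflexivity |].
    left; apply Rinv_0_lt_compat, Hm. }
  destruct (Rle_dec 0 y) as [Hy | Hy].
  - exists (acos (x / m)).
    unfold expi; rewrite cos_acos, Hs, Rabs_pos_eq by assumption.
    unfold Cmult, RtoC; simpl; f_equal; field; lra.
  - exists (- acos (x / m)).
    unfold expi; rewrite cos_neg, sin_neg, cos_acos, Hs, Rabs_left by lra.
    unfold Cmult, RtoC; simpl; f_equal; field; lra.
Qed.

Definition arg (z : C) : R := epsilon (inhabits 0) (fun t => z = (RtoC (Cmod z) * expi t)%C).

Lemma Cmod_expi_arg (z : C) : (RtoC (Cmod z) * expi (arg z))%C = z.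
Proof.
  symmetry; unfold arg; apply epsilon_spec; apply polar_form.
Qed.

(** * Angle sum *)

(** The edge of direction [s] arrives at the vertex and the one of direction [t]
    leaves it; seen from the vertex, the former lies in direction [s + PI]. *)
Definition angle_on_left (s t : R) : R := reduce (s + PI - t).

Lemma angle_on_left_eq (s t s' t' x : R) :
  expi s' = expi s -> expi t' = expi t -> 0 <= x < 2 * PI ->
  expi x = expi (s' + PI - t') -> angle_on_left s t = x.
Proof.
  intros Hs Ht Hx H; apply reduce_unique; [exact Hx |].
  rewrite H; unfold expi in *; injection Hs as Hs1 Hs2; injection Ht as Ht1 Ht2.
  rewrite !cos_minus, !sin_minus, !neg_cos, !neg_sin.
  now rewrite Hs1, Hs2, Ht1, Ht2.
Qed.

Lemma sin_pos_lt_PI (u : R) : u < 2 * PI -> 0 < sin u -> u < PI.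
Proof.
  intros Hu H; destruct (Rlt_dec u PI) as [L | L]; [exact L |].
  generalize (sin_le_0 u); lra.
Qed.

Lemma sin_neg_gt_PI (u : R) : 0 < u -> sin u < 0 -> PI < u.
Proof.
  intros Hu H; destruct (Rlt_dec PI u) as [L | L]; [exact L |].
  generalize (sin_ge_0 u); lra.
Qed.

Lemma lift_upper (t : R) : 0 < sin t -> exists s, 0 < s < PI /\ expi s = expi t.
Proof.
  intros H; exists (reduce t).
  assert (He := expi_reduce t); assert (Hb := reduce_bounds t).
  split; [| exact He].
  unfold expi in He; injection He as _ Hs.
  split.
  - destruct (Req_dec (reduce t) 0) as [E | E]; [| lra].
    rewrite E, sin_0 in Hs; lra.
  - apply sin_pos_lt_PI; lra.
Qed.

Lemma lift_lower (t : R) : sin t < 0 -> exists s, - PI < s < 0 /\ expi s = expi t.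
Proof.
  intros H.
  destruct (lift_upper (- t)) as (s & Hs & E); [rewrite sin_neg; lra |].
  exists (- s); split; [lra |].
  unfold expi in *; injection E as E1 E2.
  rewrite cos_neg in E1 |- *; rewrite sin_neg in E2 |- *.
  f_equal; lra.
Qed.

(** The situation after a rotation that makes a diagonal horizontal: two
    consecutive edges go down and up, the other two go up and down.  Lifting
    the directions to [(- PI, 0)] and [(0, PI)], the angles at the ends of the
    diagonal need no correction by [2 PI], and the last hypothesis makes those at
    the other two vertices both convex or both reflex. *)
Lemma angle_sum_split_by_line (t1 t2 t3 t4 : R) :
  sin t1 < 0 -> 0 < sin t2 -> 0 < sin t3 -> sin t4 < 0 ->
  0 < sin (t2 - t1) * sin (t4 - t3) ->
  cos ((angle_on_left t4 t1 + angle_on_left t1 t2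
        + angle_on_left t2 t3 + angle_on_left t3 t4) / 2) = -1.
Proof.
  intros H1 H2 H3 H4 H.
  destruct (lift_lower _ H1) as (s1 & B1 & E1).
  destruct (lift_upper _ H2) as (s2 & B2 & E2).
  destruct (lift_upper _ H3) as (s3 & B3 & E3).
  destruct (lift_lower _ H4) as (s4 & B4 & E4).
  assert (H' : 0 < sin (s2 - s1) * sin (s4 - s3)).
  { unfold expi in *; injection E1 as C1 S1; injection E2 as C2 S2;
      injection E3 as C3 S3; injection E4 as C4 S4.
    rewrite !sin_minus in *.
    now rewrite C1, S1, C2, S2, C3, S3, C4, S4. }
  rewrite (angle_on_left_eq t4 t1 s4 s1 (s4 + PI - s1)) by (auto || lra).
  rewrite (angle_on_left_eq t2 t3 s2 s3 (s2 + PI - s3)) by (auto || lra).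
  replace (s4 - s3) with (- (s3 - s4)) in H' by ring.
  rewrite sin_neg in H'.
  destruct (Rlt_dec 0 (sin (s2 - s1))) as [Hp | Hn].
  (* Both angles off the diagonal are convex: the sum is [2 * PI]. *)
  - assert (L1 : s2 - s1 < PI) by (apply sin_pos_lt_PI; lra).
    assert (L2 : PI < s3 - s4) by (apply sin_neg_gt_PI; nra).
    rewrite (angle_on_left_eq t1 t2 s1 s2 (s1 + PI - s2)) by (auto || lra).
    rewrite (angle_on_left_eq t3 t4 s3 s4 (s3 - PI - s4)); [| auto | auto | lra |].
    + rewrite <- cos_PI; f_equal; field.
    + rewrite <- (expi_add_IZR_period _ 1); f_equal; ring.
  (* Both angles off the diagonal are reflex: the sum is [6 * PI]. *)
  - assert (Hn' : sin (s2 - s1) < 0)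
      by (destruct (Req_dec (sin (s2 - s1)) 0) as [E |]; [rewrite E in H' |]; lra).
    assert (L1 : PI < s2 - s1) by (apply sin_neg_gt_PI; lra).
    assert (L2 : s3 - s4 < PI) by (apply sin_pos_lt_PI; nra).
    rewrite (angle_on_left_eq t3 t4 s3 s4 (s3 + PI - s4)) by (auto || lra).
    rewrite (angle_on_left_eq t1 t2 s1 s2 (s1 + 3 * PI - s2)); [| auto | auto | lra |].
    + replace ((s4 + PI - s1 + (s1 + 3 * PI - s2) + (s2 + PI - s3) + (s3 + PI - s4)) / 2)
        with (PI + 2 * INR 1 * PI) by (simpl; field).
      now rewrite cos_period, cos_PI.
    + rewrite <- (expi_add_IZR_period _ (-1)); f_equal; ring.
Qed.

Lemma angle_on_left_shift (c s t : R) : angle_on_left (s - c) (t - c) = angle_on_left s t.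
Proof. unfold angle_on_left; f_equal; ring. Qed.

(** A closed quadrilateral path whose turns at two opposite vertices have the
    same strict sign has angle sum [2 * PI] or [6 * PI]: these two vertices lie
    on different sides of the diagonal through the other two. *)
Lemma angle_sum_from_turns (r1 r2 r3 r4 t1 t2 t3 t4 : R) :
  0 < r1 -> 0 < r2 -> 0 < r3 -> 0 < r4 ->
  (RtoC r1 * expi t1 + RtoC r2 * expi t2 + RtoC r3 * expi t3 + RtoC r4 * expi t4 = 0)%C ->
  0 < sin (t2 - t1) * sin (t4 - t3) ->
  cos ((angle_on_left t4 t1 + angle_on_left t1 t2
        + angle_on_left t2 t3 + angle_on_left t3 t4) / 2) = -1.
Proof.
  intros P1 P2 P3 P4 Hsum H.
  set (x := sin (t2 - t1)) in *; set (y := sin (t4 - t3)) in *.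
  (* [d] is the diagonal, directed by means of the sign of [x] so that the first
     edge points to the right of it, whatever the orientation of the path. *)
  set (d := (RtoC x * (RtoC r1 * expi t1 + RtoC r2 * expi t2))%C).
  set (c := arg d); set (D := Cmod d).
  assert (Hd : d = (RtoC D * expi c)%C) by (symmetry; apply Cmod_expi_arg).
  assert (HD : 0 <= D) by apply Cmod_ge_0.
  unfold d, expi, Cmult, Cplus, RtoC in Hd, Hsum; simpl in Hd, Hsum.
  injection Hd as Hdx Hdy; injection Hsum as Hsx Hsy.
  assert (Hxy : x * y <> 0) by lra.
  assert (Hx2 : 0 < x * x) by (assert (x <> 0) by (intros E; apply Hxy; rewrite E; ring); nra).
  assert (neg : forall u v, v < 0 -> D * u = v -> u < 0) by (intros; nra).
  assert (pos : forall u v, 0 < v -> D * u = v -> 0 < u) by (intros; nra).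
  assert (Ex : x = sin t2 * cos t1 - cos t2 * sin t1) by apply sin_minus.
  assert (Ey : y = sin t4 * cos t3 - cos t4 * sin t3) by apply sin_minus.
  assert (Dx : D * cos c = x * (r1 * cos t1 + r2 * cos t2)) by lra.
  assert (Dy : D * sin c = x * (r1 * sin t1 + r2 * sin t2)) by lra.
  assert (Dx' : D * cos c = x * - (r3 * cos t3 + r4 * cos t4))
    by (rewrite Dx; f_equal; lra).
  assert (Dy' : D * sin c = x * - (r3 * sin t3 + r4 * sin t4))
    by (rewrite Dy; f_equal; lra).
  rewrite <- (angle_on_left_shift c t4 t1), <- (angle_on_left_shift c t1 t2),
    <- (angle_on_left_shift c t2 t3), <- (angle_on_left_shift c t3 t4).
  apply angle_sum_split_by_line.
  - apply (neg _ (- (r2 * (x * x)))); [nra |].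
    rewrite sin_minus.
    transitivity (sin t1 * (D * cos c) - cos t1 * (D * sin c)); [ring |].
    rewrite Dx, Dy, Ex; ring.
  - apply (pos _ (r1 * (x * x))); [nra |].
    rewrite sin_minus.
    transitivity (sin t2 * (D * cos c) - cos t2 * (D * sin c)); [ring |].
    rewrite Dx, Dy, Ex; ring.
  - apply (pos _ (r4 * (x * y))); [nra |].
    rewrite sin_minus.
    transitivity (sin t3 * (D * cos c) - cos t3 * (D * sin c)); [ring |].
    rewrite Dx', Dy', Ey; ring.
  - apply (neg _ (- (r3 * (x * y)))); [nra |].
    rewrite sin_minus.
    transitivity (sin t4 * (D * cos c) - cos t4 * (D * sin c)); [ring |].
    rewrite Dx', Dy', Ey; ring.
  - replace (t2 - c - (t1 - c)) with (t2 - t1) by ring.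
    replace (t4 - c - (t3 - c)) with (t4 - t3) by ring.
    exact H.
Qed.

(** * Edges of a simple quadrilateral *)

Definition prev (i : vertex) : vertex :=
  match i with v1 => v4 | v2 => v1 | v3 => v2 | v4 => v3 end.

Lemma prev_next (i : vertex) : prev (next i) = i.
Proof. now destruct i. Qed.

Lemma next_prev (i : vertex) : next (prev i) = i.
Proof. now destruct i. Qed.

Definition edge_length (a : quadrilateral) (i : vertex) : R := Cmod (a (next i) - a i)%C.

Definition heading (a : quadrilateral) (i : vertex) : R := arg (a (next i) - a i)%C.

Definition left_angle (a : quadrilateral) (i : vertex) : R :=
  angle_on_left (heading a (prev i)) (heading a i).

Lemma edge_vector (a : quadrilateral) (i : vertex) :
  (a (next i) - a i)%C = (RtoC (edge_length a i) * expi (heading a i))%C.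
Proof. symmetry; apply Cmod_expi_arg. Qed.

Lemma edge_end (a : quadrilateral) (i : vertex) :
  a (next i) = (a i + RtoC (edge_length a i) * expi (heading a i))%C.
Proof. rewrite <- edge_vector; ring. Qed.

Lemma segment_left (p q : C) : segment p q p.
Proof. exists 0; split; [lra | ring]. Qed.

Lemma segment_right (p q : C) : segment p q q.
Proof. exists 1; split; [lra | ring]. Qed.

Lemma edge_from_start (a : quadrilateral) (i : vertex) (r : R) :
  0 < edge_length a i -> 0 <= r <= edge_length a i ->
  edge a i (a i + RtoC r * expi (heading a i))%C.
Proof.
  intros Hl Hr; exists (r / edge_length a i); split.
  - split; [apply Rle_div_r | apply Rle_div_l]; lra.
  - rewrite edge_vector, RtoC_div by lra.
    field; intros E; apply RtoC_inj in E; lra.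
Qed.

Lemma edge_from_end (a : quadrilateral) (i : vertex) (r : R) :
  0 < edge_length a i -> 0 <= r <= edge_length a i ->
  edge a i (a (next i) - RtoC r * expi (heading a i))%C.
Proof.
  intros Hl Hr.
  replace (a (next i) - RtoC r * expi (heading a i))%C
    with (a i + RtoC (edge_length a i - r) * expi (heading a i))%C.
  - apply edge_from_start; lra.
  - rewrite edge_end, RtoC_minus; ring.
Qed.

(** If edge [i] were a point, this point would lie on both of its neighbours,
    which are opposite edges. *)
Lemma edge_length_pos (a : quadrilateral) (i : vertex) :
  simple_quadrilateral a -> 0 < edge_length a i.
Proof.
  intros ha; apply Cmod_gt_0; intros E.
  assert (E' : a (next i) = a i) by (rewrite <- (Cplus_0_l (a i)), <- E; ring).
  destruct (ha (prev i) (a i)) as [_ H].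
  apply H; unfold edge; rewrite next_prev.
  - apply segment_right.
  - rewrite <- E'; apply segment_left.
Qed.

(** If an edge went back along the previous one, the two would share points
    other than their common vertex. *)
Lemma no_spike (a : quadrilateral) (i : vertex) :
  simple_quadrilateral a ->
  expi (heading a (prev i)) <> (- expi (heading a i))%C.
Proof.
  intros ha E.
  assert (L1 := edge_length_pos a (prev i) ha).
  assert (L2 := edge_length_pos a i ha).
  set (r := Rmin (edge_length a (prev i)) (edge_length a i)).
  assert (Hr : 0 < r) by (apply Rmin_pos; assumption).
  assert (Hr1 : r <= edge_length a (prev i)) by apply Rmin_l.
  assert (Hr2 : r <= edge_length a i) by apply Rmin_r.
  destruct (ha (prev i) (a i + RtoC r * expi (heading a i))%C) as [H _].
  rewrite next_prev in H.
  assert (K : (a i + RtoC r * expi (heading a i) = a i)%C).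
  { apply H.
    - generalize (edge_from_end a (prev i) r L1 (conj (Rlt_le _ _ Hr) Hr1)).
      rewrite next_prev, E.
      now replace (a i - RtoC r * - expi (heading a i))%C
        with (a i + RtoC r * expi (heading a i))%C by ring.
    - apply edge_from_start; lra. }
  assert (K' : (RtoC r * expi (heading a i))%C = 0%C).
  { replace (RtoC r * expi (heading a i))%C
      with (a i + RtoC r * expi (heading a i) - a i)%C by ring.
    rewrite K; ring. }
  apply (f_equal Cmod) in K'.
  rewrite Cmod_mult, Cmod_expi, Cmod_R, Cmod_0, Rabs_pos_eq in K'; lra.
Qed.

Lemma expi_left_angle (a : quadrilateral) (i : vertex) :
  (expi (heading a i) * expi (left_angle a i) = - expi (heading a (prev i)))%C.
Proof.
  unfold left_angle, angle_on_left; rewrite expi_reduce, <- expi_plus.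
  replace (heading a i + (heading a (prev i) + PI - heading a i))
    with (heading a (prev i) + PI) by ring.
  rewrite expi_plus, expi_PI; ring.
Qed.

Lemma left_angle_bounds (a : quadrilateral) (i : vertex) :
  simple_quadrilateral a -> 0 < left_angle a i < 2 * PI.
Proof.
  intros ha.
  assert (B : 0 <= left_angle a i < 2 * PI) by apply reduce_bounds.
  destruct (Req_dec (left_angle a i) 0) as [E | E]; [exfalso | lra].
  assert (H := expi_left_angle a i); rewrite E in H.
  apply (no_spike a i ha).
  replace (expi 0) with (RtoC 1) in H
    by (unfold expi, RtoC; now rewrite cos_0, sin_0).
  rewrite Cmult_1_r in H; rewrite H; ring.
Qed.

(** * Turns of a simple quadrilateral *)

(** Twice the signed area of the triangle [p q r]. *)
Definition orient (p q r : C) : R :=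
  (fst q - fst p) * (snd r - snd p) - (snd q - snd p) * (fst r - fst p).

Lemma ratio_of_opposite_signs (x y : R) :
  x * y <= 0 -> x <> y -> 0 <= x / (x - y) <= 1.
Proof.
  intros H Hxy.
  assert (Hd : 0 < (x - y) * (x - y)) by (apply Rsqr_pos_lt; lra).
  replace (x / (x - y)) with (x * (x - y) / ((x - y) * (x - y))) by (field; lra).
  split; [apply Rle_div_r | apply Rle_div_l]; nra.
Qed.

(** If the ends of each segment are weakly on different sides of the line
    through the other one, the lines meet in a point of both segments; the last
    hypothesis excludes parallel lines. *)
Lemma straddling_segments_meet (p q r s : C) :
  orient p q r * orient p q s <= 0 -> orient r s p * orient r s q <= 0 ->
  orient p q r <> orient p q s ->
  exists z, segment p q z /\ segment r s z.
Proof.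
  intros H1 H2 H3.
  assert (D : orient r s p - orient r s q = - (orient p q r - orient p q s))
    by (unfold orient; ring).
  exists (r + RtoC (orient p q r / (orient p q r - orient p q s)) * (s - r))%C; split.
  - exists (orient r s p / (orient r s p - orient r s q)); split.
    + apply ratio_of_opposite_signs; [exact H2 | lra].
    + rewrite D.
      assert (H : orient p q r - orient p q s <> 0) by lra.
      unfold orient in *.
      destruct p as [px py], q as [qx qy], r as [rx ry], s as [sx sy].
      unfold Cplus, Cminus, Cmult, Copp, RtoC; simpl in *.
      f_equal; field; lra.
  - eexists; split; [| reflexivity].
    apply ratio_of_opposite_signs; assumption.
Qed.

(** The turn at the vertex [a (next i)]; the index is that of the edge that
    arrives there. *)
Definition turn (a : quadrilateral) (i : vertex) : R :=
  orient (a i) (a (next i)) (a (next (next i))).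

Lemma turn_eq (a : quadrilateral) (i : vertex) :
  turn a i
  = edge_length a i * edge_length a (next i) * sin (heading a (next i) - heading a i).
Proof.
  unfold turn; rewrite (edge_end a (next i)), (edge_end a i), sin_minus.
  unfold orient, Cplus, Cmult, RtoC, expi; simpl; ring.
Qed.

Lemma straight_vertex (a : quadrilateral) (i : vertex) :
  simple_quadrilateral a -> sin (heading a (next i) - heading a i) = 0 ->
  expi (heading a (next i)) = expi (heading a i).
Proof.
  intros ha H.
  assert (E : expi (heading a (next i))
    = (expi (heading a i) * RtoC (cos (heading a (next i) - heading a i)))%C).
  { replace (heading a (next i))
      with (heading a i + (heading a (next i) - heading a i)) at 1 by ring.
    rewrite expi_plus; f_equal; unfold expi; now rewrite H. }
  assert (Hc : (cos (heading a (next i) - heading a i) - 1)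
     * (cos (heading a (next i) - heading a i) + 1) = 0).
  { generalize (sin2_cos2 (heading a (next i) - heading a i)).
    rewrite H; unfold Rsqr; nra. }
  apply Rmult_integral in Hc; destruct Hc as [Hc | Hc].
  - rewrite E; replace (cos _) with 1 by lra; ring.
  - exfalso; apply (no_spike a (next i) ha); rewrite prev_next, E.
    replace (cos _) with (- (1)) by lra; rewrite RtoC_opp; ring.
Qed.

(** The path could not close up if it never changed direction. *)
Lemma not_all_straight (a : quadrilateral) :
  simple_quadrilateral a ->
  ~ (forall i, sin (heading a (next i) - heading a i) = 0).
Proof.
  intros ha H.
  assert (E := fun i => straight_vertex a i ha (H i)).
  assert (L := fun i => edge_length_pos a i ha).
  assert (S : (RtoC (edge_length a v1 + edge_length a v2 + edge_length a v3 + edge_length a v4)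
      * expi (heading a v1) = 0)%C).
  { transitivity (RtoC (edge_length a v1) * expi (heading a v1)
      + RtoC (edge_length a v2) * expi (heading a v2)
      + RtoC (edge_length a v3) * expi (heading a v3)
      + RtoC (edge_length a v4) * expi (heading a v4))%C.
    - rewrite (E v3 : expi (heading a v4) = _), (E v2 : expi (heading a v3) = _),
        (E v1 : expi (heading a v2) = _).
      rewrite !RtoC_plus; ring.
    - rewrite <- !edge_vector; simpl; ring. }
  apply (f_equal Cmod) in S.
  generalize (L v1), (L v2), (L v3), (L v4); intros.
  rewrite Cmod_mult, Cmod_expi, Cmod_R, Cmod_0, Rabs_pos_eq in S; lra.
Qed.

(** By the sign conditions, edge [i] and the opposite edge each have their ends
    weakly on different sides of the line through the other; as they do not
    meet, they must be parallel, which is the conclusion. *)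
Lemma opposite_edges_disjoint_turns (a : quadrilateral) (i : vertex) :
  simple_quadrilateral a ->
  turn a i * turn a (prev i) <= 0 -> turn a (next i) * turn a (next (next i)) <= 0 ->
  turn a i = turn a (prev i).
Proof.
  intros ha H1 H2.
  set (p := a i); set (q := a (next i)).
  set (r := a (next (next i))); set (s := a (prev i)).
  assert (E1 : turn a i = orient p q r) by reflexivity.
  assert (E2 : turn a (prev i) = orient p q s)
    by (unfold turn, orient, p, q, s; destruct i; simpl; ring).
  assert (E3 : turn a (next i) = orient r s q)
    by (unfold turn, orient, q, r, s; destruct i; simpl; ring).
  assert (E4 : turn a (next (next i)) = orient r s p)
    by (unfold turn, orient, p, r, s; destruct i; simpl; ring).
  rewrite E1, E2 in *; rewrite E3, E4 in H2.
  destruct (Req_dec (orient p q r) (orient p q s)) as [E | N]; [exact E | exfalso].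
  destruct (straddling_segments_meet p q r s) as (z & Z1 & Z2); [lra | lra | exact N |].
  apply (proj2 (ha i z)); [exact Z1 |].
  unfold edge; now replace (next (next (next i))) with (prev i) by now destruct i.
Qed.

(** Suppose that both products of opposite turns are nonpositive.  The signs
    then meet the conditions of [opposite_edges_disjoint_turns] for one of the
    two pairs of opposite edges, which makes two turns equal, hence both zero.
    The other two are equal as well, because the sum of the turns is the same
    (twice the signed area) for both pairs of opposite vertices, and so they
    vanish too. *)
Lemma opposite_turns_agree (a : quadrilateral) :
  simple_quadrilateral a ->
  exists i, 0 < sin (heading a (next i) - heading a i)
    * sin (heading a (next (next (next i))) - heading a (next (next i))).
Proof.
  intros ha.
  assert (pos : forall i, 0 < edge_length a i * edge_length a (next i))
    by (intros i; apply Rmult_lt_0_compat; now apply edge_length_pos).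
  assert (Hsum : turn a v1 + turn a v3 = turn a v2 + turn a v4)
    by (unfold turn, orient; simpl; ring).
  assert (found : forall i, 0 < turn a i * turn a (next (next i)) ->
    0 < sin (heading a (next i) - heading a i)
      * sin (heading a (next (next (next i))) - heading a (next (next i)))).
  { intros i; rewrite !turn_eq; intros P.
    assert (K := Rmult_lt_0_compat _ _ (pos i) (pos (next (next i)))).
    apply (Rmult_lt_reg_l _ _ _ K); lra. }
  destruct (Rlt_dec 0 (turn a v1 * turn a v3)) as [P1 | N1].
  { exists v1; now apply found. }
  destruct (Rlt_dec 0 (turn a v2 * turn a v4)) as [P2 | N2].
  { exists v2; now apply found. }
  exfalso.
  assert (C1 := opposite_edges_disjoint_turns a v1 ha).
  assert (C2 := opposite_edges_disjoint_turns a v2 ha).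
  simpl in C1, C2.
  assert (Q : forall x y, x * y <= 0 -> x = y -> x = 0) by (intros x y H ->; nra).
  assert (S : forall x y, ~ 0 < x * y -> 0 <= x /\ y <= 0 \/ x <= 0 /\ 0 <= y)
    by (intros x y H; destruct (Rle_dec 0 x), (Rle_dec 0 y); nra).
  assert (Z : turn a v1 = 0 /\ turn a v2 = 0 /\ turn a v3 = 0 /\ turn a v4 = 0).
  { assert (D : turn a v1 * turn a v4 <= 0 /\ turn a v2 * turn a v3 <= 0
             \/ turn a v2 * turn a v1 <= 0 /\ turn a v3 * turn a v4 <= 0).
    { destruct (S _ _ N1), (S _ _ N2); (left; split; nra) || (right; split; nra). }
    destruct D as [[D1 D2] | [D1 D2]].
    - specialize (C1 D1 D2).
      assert (turn a v1 = 0) by eauto.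
      assert (turn a v2 = 0) by (apply (Q _ (turn a v3)); lra); lra.
    - specialize (C2 D1 D2).
      assert (turn a v2 = 0) by eauto.
      assert (turn a v3 = 0) by (apply (Q _ (turn a v4)); lra); lra. }
  apply (not_all_straight a ha); intros i.
  assert (Ei : turn a i = 0) by (destruct i; apply Z).
  rewrite turn_eq in Ei; apply Rmult_integral in Ei.
  generalize (pos i); lra.
Qed.

Lemma left_angle_sum (a : quadrilateral) :
  simple_quadrilateral a ->
  cos ((left_angle a v1 + left_angle a v2 + left_angle a v3 + left_angle a v4) / 2) = -1.
Proof.
  intros ha.
  assert (L := fun i => edge_length_pos a i ha).
  destruct (opposite_turns_agree a ha) as [i Hi].
  replace (left_angle a v1 + left_angle a v2 + left_angle a v3 + left_angle a v4)
    with (left_angle a i + left_angle a (next i) + left_angle a (next (next i))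
          + left_angle a (prev i)) by (destruct i; simpl; ring).
  replace (prev i) with (next (next (next i))) in * by now destruct i.
  unfold left_angle; rewrite !prev_next.
  replace (prev i) with (next (next (next i))) by now destruct i.
  apply (angle_sum_from_turns (edge_length a i) (edge_length a (next i))
    (edge_length a (next (next i))) (edge_length a (next (next (next i))))); auto.
  rewrite <- !edge_vector.
  replace (next (next (next (next i)))) with i by now destruct i.
  ring.
Qed.

(** * Paths off the boundary *)

Lemma continuous_to_C (f g : R -> R) (t : R) :
  continuous f t -> continuous g t -> continuous (fun u => (f u, g u) : C) t.
Proof.
  intros Hf Hg.
  apply (continuous_comp_2 f g (fun x y => (x, y) : C)); try assumption.
  apply (continuous_ext (fun z : R * R => z)).
  - now intros [x y].
  - apply continuous_id.
Qed.

Lemma continuous_Rmin_l (c : R) (f : R -> R) (t : R) :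
  continuous f t -> continuous (fun u => Rmin c (f u)) t.
Proof.
  intros Hf.
  apply (continuous_ext (fun u => (c + f u - Rabs (c - f u)) / 2)).
  - intros u; unfold Rmin, Rabs; destruct (Rle_dec c (f u)), (Rcase_abs (c - f u)); simpl; lra.
  - apply (continuous_mult (fun u => c + f u - Rabs (c - f u)) (fun _ => / 2));
      [| apply continuous_const].
    apply (continuous_minus (fun u => c + f u) (fun u => Rabs (c - f u))).
    + apply (continuous_plus (fun _ => c) f); [apply continuous_const | exact Hf].
    + apply continuous_Rabs_comp.
      apply (continuous_minus (fun _ => c) f); [apply continuous_const | exact Hf].
Qed.

(** The concatenation of [g] and [h] is written as a sum in which one of the
    two paths is at rest at the common point [w]; it is thus continuous as a
    composition, without a gluing argument. *)
Lemma joined_off_boundary_trans (a : quadrilateral) (z w y : C) :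
  joined_off_boundary a z w -> joined_off_boundary a w y -> joined_off_boundary a z y.
Proof.
  intros (g & Cg & G0 & G1 & Bg) (h & Ch & H0 & H1 & Bh).
  exists (fun t => (g (Rmin 1 (2 * t)) + h (2 * t - Rmin 1 (2 * t))%R - w)%C).
  assert (Cm : forall t, continuous (fun u => Rmin 1 (2 * u)) t).
  { intros t; apply continuous_Rmin_l.
    apply (ex_derive_continuous (fun u => 2 * u)); auto_derive; auto. }
  split; [| split; [| split]].
  - intros t.
    apply (continuous_minus (fun u => plus (g (Rmin 1 (2 * u))) (h (2 * u - Rmin 1 (2 * u))))
             (fun _ => w)); [| apply continuous_const].
    apply (continuous_plus (fun u => g (Rmin 1 (2 * u)))
             (fun u => h (2 * u - Rmin 1 (2 * u)))).
    + apply (continuous_comp (fun u => Rmin 1 (2 * u)) g); auto.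
    + apply (continuous_comp (fun u => 2 * u - Rmin 1 (2 * u)) h); auto.
      apply (continuous_minus (fun u => 2 * u) (fun u => Rmin 1 (2 * u))); auto.
      apply (ex_derive_continuous (fun u => 2 * u)); auto_derive; auto.
  - rewrite Rmin_right by lra.
    replace (2 * 0 - 2 * 0) with 0 by ring; replace (2 * 0) with 0 by ring.
    rewrite G0, H0; ring.
  - rewrite Rmin_left by lra.
    replace (2 * 1 - 1) with 1 by ring.
    rewrite G1, H1; ring.
  - intros t Ht.
    destruct (Rle_dec (2 * t) 1) as [L | L].
    + rewrite Rmin_right by lra.
      replace (2 * t - 2 * t) with 0 by ring; rewrite H0.
      replace (g (2 * t)%R + w - w)%C with (g (2 * t)) by ring.
      apply Bg; lra.
    + rewrite Rmin_left by lra; rewrite G1.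
      replace (w + h (2 * t - 1)%R - w)%C with (h (2 * t - 1)) by ring.
      apply Bh; lra.
Qed.

Lemma joined_off_boundary_sym (a : quadrilateral) (z w : C) :
  joined_off_boundary a z w -> joined_off_boundary a w z.
Proof.
  intros (g & Cg & G0 & G1 & Bg).
  exists (fun t => g (1 - t)); split; [| split; [| split]].
  - intros t; apply (continuous_comp (fun u => 1 - u) g); auto.
    apply (ex_derive_continuous (fun u => 1 - u)); auto_derive; auto.
  - now rewrite Rminus_0_r.
  - now rewrite Rminus_diag.
  - intros t Ht; apply Bg; lra.
Qed.

Lemma interior_region_joined (a : quadrilateral) (z w : C) :
  joined_off_boundary a z w -> (interior_region a z <-> interior_region a w).
Proof.
  assert (H : forall x y, joined_off_boundary a x y ->
            interior_region a x -> interior_region a y).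
  { intros x y J [_ [M HM]]; split.
    - destruct J as (g & _ & _ & G1 & Bg); rewrite <- G1; apply Bg; lra.
    - exists M; intros v Hv; apply HM.
      now apply (joined_off_boundary_trans a x y v). }
  intros J; split; apply H; [| apply joined_off_boundary_sym]; assumption.
Qed.

Lemma arc_joined (a : quadrilateral) (p : C) (r s t : R) :
  (forall u, 0 <= u <= 1 -> ~ boundary a (p + RtoC r * expi (s + u * (t - s))%R)%C) ->
  joined_off_boundary a (p + RtoC r * expi s)%C (p + RtoC r * expi t)%C.
Proof.
  intros H; exists (fun u => (p + RtoC r * expi (s + u * (t - s))%R)%C); split; [| split; [| split]].
  - intros u; apply continuous_to_C; simpl.
    + apply (ex_derive_continuous (fun u => _ + (r * cos (s + u * (t - s)) - 0 * _)));
        auto_derive; auto.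
    + apply (ex_derive_continuous (fun u => _ + (r * sin (s + u * (t - s)) + 0 * _)));
        auto_derive; auto.
  - now replace (s + 0 * (t - s)) with s by ring.
  - now replace (s + 1 * (t - s)) with t by ring.
  - exact H.
Qed.

Lemma segment_joined (a : quadrilateral) (p q : C) :
  (forall z, segment p q z -> ~ boundary a z) -> joined_off_boundary a p q.
Proof.
  intros H; exists (fun u => (p + RtoC u * (q - p))%C); split; [| split; [| split]].
  - intros u; apply continuous_to_C; simpl.
    + apply (ex_derive_continuous (fun u => fst p + (u * (fst q + - fst p) - 0 * (snd q + - snd p))));
        auto_derive; auto.
    + apply (ex_derive_continuous (fun u => snd p + (u * (snd q + - snd p) + 0 * (fst q + - fst p))));
        auto_derive; auto.
  - ring.
  - ring.
  - intros u Hu; apply H; now exists u.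
Qed.

(** Compactness of the square of parameters, in the form of Cousin's lemma for a
    gauge proportional to the distance of the two points. *)
Lemma disjoint_segments_apart (p q r s : C) :
  (forall z, segment p q z -> ~ segment r s z) ->
  exists eta, 0 < eta /\
    forall z w, segment p q z -> segment r s w -> eta <= Cmod (z - w).
Proof.
  intros H.
  set (Z u := (p + RtoC u * (q - p))%C); set (W v := (r + RtoC v * (s - r))%C).
  set (K := Cmod (q - p) + Cmod (s - r) + 1).
  assert (HK : 0 < K) by (unfold K; generalize (Cmod_ge_0 (q - p)), (Cmod_ge_0 (s - r)); lra).
  (* The distances are positive on the square; the second branch only makes
     [delta] total. *)
  set (delta u v := match Rlt_dec 0 (Cmod (Z u - W v) / (2 * K)) with
    | left h => mkposreal _ h | right _ => mkposreal 1 Rlt_0_1 end).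
  destruct (compactness_value_2d 0 1 0 1 delta) as [d Hd].
  exists (K * d); split; [apply Rmult_lt_0_compat; [lra | apply cond_pos] |].
  intros z w (x & Hx & ->) (y & Hy & ->); fold (Z x); fold (W y).
  apply Rnot_lt_le; intros Hlt.
  apply (Hd x y Hx Hy); intros (u & v & Hu & Hv & Hxu & Hyv & Hle).
  assert (Hpos : 0 < Cmod (Z u - W v)).
  { apply Cmod_gt_0; intros E.
    apply (H (Z u)); [now exists u |].
    exists v; split; [exact Hv |].
    fold (W v); rewrite <- (Cplus_0_r (W v)), <- E; ring. }
  assert (Hdelta : 2 * K * delta u v = Cmod (Z u - W v)).
  { unfold delta; destruct (Rlt_dec _ _) as [h | h]; simpl.
    - field; lra.
    - destruct h; apply Rdiv_lt_0_compat; lra. }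
  assert (Hmove : forall (b c : C) (m n : R), Rabs (m - n) < delta u v ->
    Cmod ((b + RtoC n * c) - (b + RtoC m * c)) <= delta u v * Cmod c).
  { intros b c m n Hmn.
    replace ((b + RtoC n * c) - (b + RtoC m * c))%C with (RtoC (n - m) * c)%C
      by (rewrite RtoC_minus; ring).
    rewrite Cmod_mult, Cmod_R, Rabs_minus_sym.
    apply Rmult_le_compat_r; [apply Cmod_ge_0 | lra]. }
  assert (Hz := Hmove p (q - p)%C x u Hxu); fold (Z u) (Z x) in Hz.
  assert (Hw := Hmove r (s - r)%C y v Hyv); fold (W v) (W y) in Hw.
  assert (Htri : Cmod (Z u - W v)
    <= Cmod (Z x - W y) + Cmod (Z u - Z x) + Cmod (W v - W y)).
  { replace (Z u - W v)%C with ((Z x - W y) + (Z u - Z x) + - (W v - W y))%C by ring.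
    rewrite <- (Cmod_opp (W v - W y)).
    eapply Rle_trans; [apply Cmod_triangle |].
    apply Rplus_le_compat_r, Cmod_triangle. }
  assert (Hd0 := cond_pos (delta u v)).
  assert (K * d <= K * delta u v) by (apply Rmult_le_compat_l; lra).
  unfold K in *; nra.
Qed.

(** * The interior near the boundary *)

Lemma uniform_on_vertices (Q : vertex -> R -> Prop) :
  (forall i, exists eps, 0 < eps /\ forall r, 0 < r < eps -> Q i r) ->
  exists eps, 0 < eps /\ forall r, 0 < r < eps -> forall i, Q i r.
Proof.
  intros H.
  destruct (H v1) as (e1 & P1 & H1), (H v2) as (e2 & P2 & H2),
    (H v3) as (e3 & P3 & H3), (H v4) as (e4 & P4 & H4).
  exists (Rmin (Rmin e1 e2) (Rmin e3 e4)); split.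
  - repeat apply Rmin_pos; assumption.
  - intros r [Hr0 Hr].
    apply Rmin_Rgt_l in Hr; destruct Hr as [Ha Hb].
    apply Rmin_Rgt_l in Ha; apply Rmin_Rgt_l in Hb.
    intros []; [apply H1 | apply H2 | apply H3 | apply H4]; lra.
Qed.

Lemma vertex_cases (i j : vertex) :
  j = i \/ j = next i \/ j = next (next i) \/ j = prev i.
Proof. destruct i, j; simpl; auto. Qed.

Lemma vertex_off_other_edges (a : quadrilateral) (i : vertex) :
  simple_quadrilateral a ->
  ~ edge a (next i) (a i) /\ ~ edge a (next (next i)) (a i).
Proof.
  intros ha; split; intros H.
  - destruct (ha (prev i) (a i)) as [_ K].
    rewrite next_prev in K; apply K; [| exact H].
    unfold edge; rewrite next_prev; apply segment_right.
  - apply (proj2 (ha i (a i))); [apply segment_left | exact H].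
Qed.

Lemma same_direction (r s t : R) (z : C) :
  0 < r -> 0 <= s -> Cmod z = 1 -> (RtoC r * expi t = RtoC s * z)%C -> expi t = z.
Proof.
  intros Hr Hs Hz H.
  assert (E : r = s).
  { apply (f_equal Cmod) in H.
    rewrite !Cmod_mult, Cmod_expi, Hz, !Cmod_R, !Rabs_pos_eq in H; lra. }
  subst s.
  assert (Hr' : RtoC r <> 0%C) by (intros E; apply RtoC_inj in E; lra).
  transitivity (/ RtoC r * (RtoC r * expi t))%C; [field; exact Hr' |].
  rewrite H; field; exact Hr'.
Qed.

(** The two edges that do not contain the vertex are at a positive distance
    from it. *)
Lemma boundary_near_vertex (a : quadrilateral) (i : vertex) :
  simple_quadrilateral a ->
  exists eps, 0 < eps /\ forall r, 0 < r < eps -> forall t,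
    boundary a (a i + RtoC r * expi t)%C ->
    expi t = expi (heading a i) \/ expi t = (- expi (heading a (prev i)))%C.
Proof.
  intros ha; destruct (vertex_off_other_edges a i ha) as [N1 N2].
  assert (D : forall j, ~ edge a j (a i) ->
    exists eta, 0 < eta /\ forall w, edge a j w -> eta <= Cmod (a i - w)).
  { intros j Hj.
    destruct (disjoint_segments_apart (a i) (a i) (a j) (a (next j))) as (eta & He & H).
    - intros z (u & _ & ->) Hz; apply Hj.
      now replace (a i + RtoC u * (a i - a i))%C with (a i) in Hz by ring.
    - exists eta; split; [exact He |].
      intros w Hw; apply H; [apply segment_left | exact Hw]. }
  destruct (D _ N1) as (e1 & P1 & H1), (D _ N2) as (e2 & P2 & H2).
  exists (Rmin e1 e2); split; [apply Rmin_pos; assumption |].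
  intros r [Hr0 Hr] t [j Hj]; apply Rmin_Rgt_l in Hr.
  assert (Hc : Cmod (a i - (a i + RtoC r * expi t)) = r).
  { replace (a i - (a i + RtoC r * expi t))%C with (- (RtoC r * expi t))%C by ring.
    rewrite Cmod_opp, Cmod_mult, Cmod_expi, Cmod_R, Rabs_pos_eq; lra. }
  destruct (vertex_cases i j) as [-> | [-> | [-> | ->]]].
  - left; destruct Hj as (s & Hs & E); rewrite edge_vector in E.
    apply (same_direction r (s * edge_length a i) t _ Hr0).
    + apply Rmult_le_pos; [lra | apply Cmod_ge_0].
    + apply Cmod_expi.
    + transitivity (a i + RtoC r * expi t - a i)%C; [ring |].
      rewrite E, RtoC_mult; ring.
  - apply H1 in Hj; lra.
  - apply H2 in Hj; lra.
  - right; destruct Hj as (s & Hs & E); rewrite edge_vector in E.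
    apply (same_direction r ((1 - s) * edge_length a (prev i)) t _ Hr0).
    + apply Rmult_le_pos; [lra | apply Cmod_ge_0].
    + rewrite Cmod_opp; apply Cmod_expi.
    + transitivity (a i + RtoC r * expi t - a i)%C; [ring |].
      rewrite E, RtoC_mult, RtoC_minus.
      generalize (edge_end a (prev i)); rewrite next_prev; intros ->; ring.
Qed.

(** The set [S] of directions is an open arc of length [theta] starting at
    [phi], and it is constant on each of the two arcs cut out by [t0] and
    [t0 + beta].  Constancy forbids [S] to start or to end inside one of these
    arcs; since [theta < 2 * PI], it cannot start and end at the same point
    either. *)
Lemma arc_is_one_of_two_arcs (S : R -> Prop) (t0 beta phi theta : R) :
  0 < beta < 2 * PI -> 0 < theta < 2 * PI ->
  (forall x y, expi x = expi y -> S x -> S y) ->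
  ~ S t0 -> ~ S (t0 + beta) ->
  (forall x y, t0 < x < t0 + beta -> t0 < y < t0 + beta -> S x -> S y) ->
  (forall x y, t0 + beta < x < t0 + 2 * PI -> t0 + beta < y < t0 + 2 * PI -> S x -> S y) ->
  (forall t, 0 <= t < 2 * PI -> (S (phi + t) <-> 0 < t < theta)) ->
  (theta = beta /\ forall x, t0 < x < t0 + beta -> S x) \/
  (theta = 2 * PI - beta /\ forall x, t0 < x < t0 + beta -> ~ S x).
Proof.
  intros Hb Ht per N0 N1 CL CR HS.
  set (psi := t0 + reduce (phi - t0)).
  assert (Hpsi : t0 <= psi < t0 + 2 * PI)
    by (generalize (reduce_bounds (phi - t0)); unfold psi; lra).
  assert (H : forall x, psi <= x < psi + 2 * PI -> (S x <-> psi < x < psi + theta)).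
  { intros x Hx.
    assert (E : expi (phi + (x - psi)) = expi x).
    { unfold psi; replace x with (t0 + (phi - t0) + (x - phi)) at 2 by ring.
      replace (phi + (x - (t0 + reduce (phi - t0))))
        with (phi - t0 + (x - reduce (phi - t0))) by ring.
      replace (t0 + (phi - t0) + (x - phi)) with (reduce (phi - t0) + (x - reduce (phi - t0))) by ring.
      now rewrite (expi_plus (phi - t0)), (expi_plus (reduce (phi - t0))), expi_reduce. }
    transitivity (S (phi + (x - psi))).
    - split; apply per; auto.
    - rewrite HS by lra; lra. }
  assert (per2 : forall x, S (x + 2 * PI) <-> S x).
  { intros x; split; apply per; rewrite <- (expi_add_IZR_period x 1), Rmult_1_r; auto. }
  clearbody psi.
  destruct (Rtotal_order psi (t0 + beta)) as [L | [E | G]].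
  - destruct (Req_dec psi t0) as [E | E].
    + left; subst psi.
      assert (theta = beta).
      { destruct (Rtotal_order theta beta) as [L' | [E' | G']]; [| exact E' |]; exfalso.
        - assert (K : S (t0 + theta)).
          { apply (CL (t0 + theta / 2)); [lra | lra |]; apply H; lra. }
          apply H in K; lra.
        - apply N1, H; lra. }
      split; [assumption |]; intros x Hx; apply H; lra.
    + exfalso.
      set (m := Rmin (psi + theta) (t0 + beta)).
      assert (Hm : psi < m) by (apply Rmin_glb_lt; lra).
      assert (Hm1 : m <= psi + theta) by apply Rmin_l.
      assert (Hm2 : m <= t0 + beta) by apply Rmin_r.
      assert (K : S psi) by (apply (CL ((psi + m) / 2)); [lra | lra |]; apply H; lra).
      apply H in K; lra.
  - right; subst psi.
    assert (theta = 2 * PI - beta).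
    { destruct (Rtotal_order theta (2 * PI - beta)) as [L' | [E' | G']]; [| exact E' |]; exfalso.
      - assert (K : S (t0 + beta + theta)).
        { apply (CR (t0 + beta + theta / 2)); [lra | lra |]; apply H; lra. }
        apply H in K; lra.
      - apply N0, per2, H; lra. }
    split; [assumption |]; intros x Hx K.
    apply per2, H in K; lra.
  - exfalso.
    set (m := Rmin (psi + theta) (t0 + 2 * PI)).
    assert (Hm : psi < m) by (apply Rmin_glb_lt; lra).
    assert (Hm1 : m <= psi + theta) by apply Rmin_l.
    assert (Hm2 : m <= t0 + 2 * PI) by apply Rmin_r.
    assert (K : S psi) by (apply (CR ((psi + m) / 2)); [lra | lra |]; apply H; lra).
    apply H in K; lra.
Qed.

Definition interior_on_left (a : quadrilateral) (i : vertex) (r theta : R) : Prop :=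
  theta = left_angle a i /\
  forall x, heading a i < x < heading a i + left_angle a i ->
    interior_region a (a i + RtoC r * expi x)%C.

Definition interior_on_right (a : quadrilateral) (i : vertex) (r theta : R) : Prop :=
  theta = 2 * PI - left_angle a i /\
  forall x, heading a i < x < heading a i + left_angle a i ->
    ~ interior_region a (a i + RtoC r * expi x)%C.

Lemma expi_heading_plus_left_angle (a : quadrilateral) (i : vertex) :
  expi (heading a i + left_angle a i) = (- expi (heading a (prev i)))%C.
Proof. rewrite expi_plus; apply expi_left_angle. Qed.

Lemma between_convex (l h x y u : R) :
  l < x < h -> l < y < h -> 0 <= u <= 1 -> l < x + u * (y - x) < h.
Proof.
  intros Hx Hy Hu; destruct (Rle_dec x y).
  - assert (x <= x + u * (y - x) <= y) by nra; lra.
  - assert (y <= x + u * (y - x) <= x) by nra; lra.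
Qed.

(** Both arcs of a small circle around the vertex are connected and off the
    boundary, and the two points that separate them are on the edges. *)
Lemma interior_on_one_side (a : quadrilateral) (i : vertex) (theta : R) :
  simple_quadrilateral a -> is_interior_angle a i theta ->
  exists eps, 0 < eps /\ forall r, 0 < r < eps ->
    interior_on_left a i r theta \/ interior_on_right a i r theta.
Proof.
  intros ha (Ht & phi & e1 & P1 & H1).
  destruct (boundary_near_vertex a i ha) as (e2 & P2 & H2).
  assert (L1 := edge_length_pos a i ha).
  assert (L2 := edge_length_pos a (prev i) ha).
  assert (Hb := left_angle_bounds a i ha).
  exists (Rmin (Rmin e1 e2) (Rmin (edge_length a i) (edge_length a (prev i)))); split.
  { repeat apply Rmin_pos; assumption. }
  intros r [Hr0 Hr].
  apply Rmin_Rgt_l in Hr; destruct Hr as [Ha Hc].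
  apply Rmin_Rgt_l in Ha; apply Rmin_Rgt_l in Hc.
  assert (off : forall x, heading a i < x < heading a i + 2 * PI ->
    x <> heading a i + left_angle a i -> ~ boundary a (a i + RtoC r * expi x)%C).
  { intros x Hx Hne B; apply H2 in B; [| lra].
    rewrite <- expi_heading_plus_left_angle in B.
    destruct B as [B | B]; apply expi_inj in B; (lra || apply Rabs_def1; lra). }
  apply (arc_is_one_of_two_arcs (fun x => interior_region a (a i + RtoC r * expi x)%C) _ _ phi).
  - exact Hb.
  - exact Ht.
  - intros x y E; now rewrite E.
  - intros [N _]; apply N; exists i; apply edge_from_start; lra.
  - rewrite expi_heading_plus_left_angle; intros [N _]; apply N; exists (prev i).
    generalize (edge_from_end a (prev i) r L2); rewrite next_prev; intros K.
    replace (a i + RtoC r * - expi (heading a (prev i)))%C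
      with (a i - RtoC r * expi (heading a (prev i)))%C by ring.
    apply K; lra.
  - intros x y Hx Hy; apply interior_region_joined, arc_joined.
    intros u Hu; assert (K := between_convex _ _ y x u Hy Hx Hu); apply off; [lra | apply Rlt_not_eq; lra].
  - intros x y Hx Hy; apply interior_region_joined, arc_joined.
    intros u Hu; assert (K := between_convex _ _ y x u Hy Hx Hu); apply off; [lra | apply Rgt_not_eq; lra].
  - intros t Ht'; apply H1; lra.
Qed.

(** An edge with its ends removed keeps a positive distance from the other
    edges, although its neighbours touch it at the ends. *)
Lemma inner_edge_apart (a : quadrilateral) (i : vertex) (r : R) :
  simple_quadrilateral a -> 0 < r ->
  exists eta, 0 < eta /\ forall j x w, j <> i -> r <= x <= edge_length a i - r ->
    edge a j w -> eta <= Cmod (a i + RtoC x * expi (heading a i) - w).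
Proof.
  intros ha Hr.
  assert (Li := edge_length_pos a i ha).
  set (w := expi (heading a i)).
  assert (off : forall j x, j <> i -> r <= x <= edge_length a i - r ->
    ~ edge a j (a i + RtoC x * w)%C).
  { intros j x Hj Hx Hz.
    assert (Hi : edge a i (a i + RtoC x * w)%C) by (apply edge_from_start; lra).
    assert (far : forall y, x <> y -> (a i + RtoC x * w)%C <> (a i + RtoC y * w)%C).
    { intros y Hxy E; apply Hxy.
      assert (E' : (RtoC (x - y) * w)%C = 0%C).
      { replace (RtoC (x - y) * w)%C with (a i + RtoC x * w - (a i + RtoC y * w))%C
          by (rewrite RtoC_minus; ring).
        rewrite E; ring. }
      apply (f_equal Cmod) in E'.
      unfold w in E'; rewrite Cmod_mult, Cmod_expi, Cmod_R, Cmod_0 in E'.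
      destruct (Req_dec (x - y) 0); [lra |].
      generalize (Rabs_pos_lt (x - y)); lra. }
    destruct (vertex_cases i j) as [-> | [-> | [-> | ->]]].
    - now apply Hj.
    - apply (far (edge_length a i)); [lra |].
      unfold w at 2; rewrite <- edge_end; now apply (ha i).
    - now apply (proj2 (ha i (a i + RtoC x * w)%C)).
    - apply (far 0); [lra |].
      destruct (ha (prev i) (a i + RtoC x * w)%C) as [K _].
      rewrite next_prev in K; rewrite K by assumption; ring. }
  destruct (uniform_on_vertices (fun j eta => j <> i ->
    forall x v, r <= x <= edge_length a i - r -> edge a j v ->
      eta <= Cmod (a i + RtoC x * w - v))) as (e & He & H).
  - intros j.
    destruct (Rlt_dec (edge_length a i - r) r) as [Hlt | Hge].
    { exists 1; split; [lra |]; intros; lra. }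
    destruct (classic (j = i)) as [-> | Hj].
    { exists 1; split; [lra |]; intros; congruence. }
    set (d := edge_length a i - 2 * r).
    assert (seg : forall z,
      segment (a i + RtoC r * w)%C (a i + RtoC (edge_length a i - r) * w)%C z <->
      exists x, r <= x <= edge_length a i - r /\ z = (a i + RtoC x * w)%C).
    { intros z; split.
      - intros (u & Hu & ->); exists (r + u * d); split; [unfold d; nra |].
        unfold d; rewrite RtoC_plus, RtoC_mult, !RtoC_minus, RtoC_mult; ring.
      - intros (x & Hx & ->).
        destruct (Req_dec d 0) as [E | E].
        + unfold d in E; replace x with r by lra; apply segment_left.
        + exists ((x - r) / d); split.
          * unfold d in *; split; [apply Rle_div_r | apply Rle_div_l]; lra.
          * replace (RtoC x) with (RtoC r + RtoC ((x - r) / d) * RtoC d)%C.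
            -- unfold d; rewrite !RtoC_minus, RtoC_mult; ring.
            -- rewrite <- RtoC_mult, <- RtoC_plus; f_equal; field; exact E. }
    destruct (disjoint_segments_apart (a i + RtoC r * w)%C
      (a i + RtoC (edge_length a i - r) * w)%C (a j) (a (next j))) as (e & He & H).
    + intros z Hz; apply seg in Hz; destruct Hz as (x & Hx & ->); now apply off.
    + exists e; split; [exact He |].
      intros e' He' _ x v Hx Hv; transitivity e; [lra |].
      apply H; [apply seg; now exists x | exact Hv].
  - exists (e / 2); split; [lra |].
    intros j x v Hj Hx Hv; apply (H (e / 2)) with (i := j); auto; lra.
Qed.

(** The segment between the two points is parallel to the edge at the distance
    [r * sin delta], too close for the other edges to be reached when [delta]
    is small. *)
Lemma same_side_at_both_ends (a : quadrilateral) (i : vertex) (r kappa : R) :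
  simple_quadrilateral a -> 0 < r -> 2 * r < edge_length a i -> 0 < kappa ->
  exists delta, 0 < delta < kappa /\
    (interior_region a (a i + RtoC r * expi (heading a i + delta)%R)%C <->
     interior_region a (a (next i) + RtoC r * expi (heading a i + PI - delta)%R)%C).
Proof.
  intros ha Hr Hl Hk.
  destruct (inner_edge_apart a i (r / 2) ha ltac:(lra)) as (eta & He & Hsep).
  set (delta := Rmin (Rmin kappa (PI / 3)) (eta / r) / 2).
  assert (HPI := PI_RGT_0).
  assert (Hm : 0 < Rmin (Rmin kappa (PI / 3)) (eta / r)).
  { repeat apply Rmin_pos; try lra; apply Rdiv_lt_0_compat; lra. }
  assert (Hm1 := Rmin_l (Rmin kappa (PI / 3)) (eta / r)).
  assert (Hm2 := Rmin_r (Rmin kappa (PI / 3)) (eta / r)).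
  assert (Hm3 := Rmin_l kappa (PI / 3)).
  assert (Hm4 := Rmin_r kappa (PI / 3)).
  assert (Hdk : 0 < delta < kappa) by (unfold delta; lra).
  assert (Hd3 : delta < PI / 3) by (unfold delta; lra).
  assert (Hde : r * delta < eta).
  { assert (delta < eta / r) by (unfold delta; lra).
    replace eta with (r * (eta / r)) by (field; lra).
    apply Rmult_lt_compat_l; lra. }
  clearbody delta; clear Hm Hm1 Hm2 Hm3 Hm4.
  exists delta; split; [exact Hdk |].
  apply interior_region_joined, segment_joined.
  intros z (u & Hu & Hz) [j Hj].
  assert (Hcos : 1 / 2 < cos delta) by (rewrite <- cos_PI3; apply cos_decreasing_1; lra).
  assert (Hcos1 := COS_bound delta).
  assert (Hsin : 0 < sin delta) by (apply sin_gt_0; lra).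
  assert (Hsin1 : sin delta < delta) by (apply sin_lt_x; lra).
  set (w := expi (heading a i)) in *.
  set (x := r * cos delta + u * (edge_length a i - 2 * (r * cos delta))).
  assert (Ez : z = (a i + RtoC x * w + RtoC (r * sin delta) * Ci * w)%C).
  { rewrite Hz, edge_end; fold w.
    unfold Rminus; rewrite !expi_plus, expi_PI; fold w.
    replace (expi delta) with (RtoC (cos delta) + Ci * RtoC (sin delta))%C
      by (unfold expi, Ci, RtoC, Cplus, Cmult; simpl; f_equal; ring).
    replace (expi (- delta)) with (RtoC (cos delta) - Ci * RtoC (sin delta))%C
      by (unfold expi; rewrite cos_neg, sin_neg;
          unfold Ci, RtoC, Cminus, Copp, Cplus, Cmult; simpl; f_equal; ring).
    unfold x; rewrite RtoC_plus, !RtoC_mult, RtoC_minus, !RtoC_mult; ring. }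
  assert (Hx : r / 2 <= x <= edge_length a i - r / 2).
  { assert (r / 2 <= r * cos delta <= r) by nra.
    unfold x; nra. }
  destruct (classic (j = i)) as [-> | Hji].
  (* On the edge itself, the component orthogonal to it would vanish. *)
  - destruct Hj as (s & Hs & E); rewrite edge_vector in E; fold w in E.
    assert (K : ((RtoC (x - s * edge_length a i) + RtoC (r * sin delta) * Ci) * w = 0)%C).
    { transitivity (z - z)%C; [| ring].
      rewrite Ez at 1; rewrite E.
      rewrite RtoC_minus, (RtoC_mult s); ring. }
    apply (f_equal (fun v => v * / w)%C) in K.
    replace ((RtoC (x - s * edge_length a i) + RtoC (r * sin delta) * Ci) * w * / w)%C
      with (RtoC (x - s * edge_length a i) + RtoC (r * sin delta) * Ci)%C in K
      by (field; apply expi_neq_0).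
    rewrite Cmult_0_l in K.
    apply (f_equal snd) in K; simpl in K; nra.
  - assert (K := Hsep j x z Hji Hx Hj); fold w in K.
    replace (a i + RtoC x * w - z)%C with (- (RtoC (r * sin delta) * Ci * w))%C in K
      by (rewrite Ez; ring).
    unfold w in K; rewrite Cmod_opp, !Cmod_mult, Cmod_expi, Cmod_R, Rabs_pos_eq in K by nra.
    replace (Cmod Ci) with 1 in K.
    + nra.
    + unfold Cmod, Ci; simpl; replace (0 * (0 * 1) + 1 * (1 * 1)) with 1 by ring.
      now rewrite sqrt_1.
Qed.

(** A single radius [r] is used at all vertices: when a left angle is [PI], the
    value of [theta] does not determine the side, which could then depend on
    the radius. *)
Lemma interior_angles_on_same_side (a : quadrilateral) (theta : vertex -> R) :
  simple_quadrilateral a -> (forall i, is_interior_angle a i (theta i)) ->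
  (forall i, theta i = left_angle a i) \/ (forall i, theta i = 2 * PI - left_angle a i).
Proof.
  intros ha Htheta.
  destruct (uniform_on_vertices (fun i r =>
    (interior_on_left a i r (theta i) \/ interior_on_right a i r (theta i))
    /\ 2 * r < edge_length a i)) as (e & He & H).
  { intros i; destruct (interior_on_one_side a i (theta i) ha (Htheta i)) as (e & He & H).
    assert (L := edge_length_pos a i ha).
    exists (Rmin e (edge_length a i / 2)); split; [apply Rmin_pos; lra |].
    intros r [Hr0 Hr]; apply Rmin_Rgt_l in Hr; split; [apply H |]; lra. }
  set (r := e / 2).
  assert (Hr : 0 < r) by (unfold r; lra).
  assert (side := fun i => proj1 (H r ltac:(unfold r; lra) i)).
  assert (len := fun i => proj2 (H r ltac:(unfold r; lra) i)).
  clearbody r; clear H e He.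
  (* The second point is just before the end of the left sector at [next i],
     which is bounded by edge [i] traversed backwards. *)
  assert (transport : forall i, exists x y,
    heading a i < x < heading a i + left_angle a i /\
    heading a (next i) < y < heading a (next i) + left_angle a (next i) /\
    (interior_region a (a i + RtoC r * expi x)%C <->
     interior_region a (a (next i) + RtoC r * expi y)%C)).
  { intros i.
    assert (B1 := left_angle_bounds a i ha).
    assert (B2 := left_angle_bounds a (next i) ha).
    destruct (same_side_at_both_ends a i r (Rmin (left_angle a i) (left_angle a (next i))))
      as (d & [Hd0 Hd] & Hi); auto.
    { apply Rmin_pos; lra. }
    apply Rmin_Rgt_l in Hd.
    exists (heading a i + d), (heading a (next i) + left_angle a (next i) - d).
    split; [lra |]; split; [lra |].
    rewrite Hi.
    replace (expi (heading a (next i) + left_angle a (next i) - d))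
      with (expi (heading a i + PI - d)); [reflexivity |].
    unfold Rminus.
    rewrite (expi_plus (heading a i + PI)), (expi_plus (_ + left_angle _ _)).
    rewrite expi_heading_plus_left_angle, prev_next, (expi_plus _ PI), expi_PI.
    ring. }
  assert (stepL : forall i, interior_on_left a i r (theta i) ->
    interior_on_left a (next i) r (theta (next i))).
  { intros i [_ Li]; destruct (side (next i)) as [L | [_ R']]; [exact L |].
    destruct (transport i) as (x & y & Hx & Hy & K).
    destruct (R' y Hy); now apply K, Li. }
  assert (stepR : forall i, interior_on_right a i r (theta i) ->
    interior_on_right a (next i) r (theta (next i))).
  { intros i [_ Ri]; destruct (side (next i)) as [[_ L] | R']; [| exact R'].
    destruct (transport i) as (x & y & Hx & Hy & K).
    destruct (Ri x Hx); now apply K, L. }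
  destruct (side v1) as [L | R'].
  - left; assert (L2 := stepL _ L); assert (L3 := stepL _ L2); assert (L4 := stepL _ L3).
    intros []; [apply L | apply L2 | apply L3 | apply L4].
  - right; assert (R2 := stepR _ R'); assert (R3 := stepR _ R2); assert (R4 := stepR _ R3).
    intros []; [apply R' | apply R2 | apply R3 | apply R4].
Qed.

(** Taking [2 * PI - beta] for each left angle [beta] turns the half sum [s] into
    [4 * PI - s], which has the same cosine. *)
Lemma expi_half_angle_sum (a : quadrilateral) (alpha : vertex -> R) :
  simple_quadrilateral a -> (forall i, is_interior_angle a i (2 * alpha i)) ->
  expi (alpha v1 + alpha v2 + alpha v3 + alpha v4) = (- (1))%C.
Proof.
  intros ha H.
  assert (Hc : cos (alpha v1 + alpha v2 + alpha v3 + alpha v4) = -1).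
  { rewrite <- (left_angle_sum a ha).
    destruct (interior_angles_on_same_side a (fun i => 2 * alpha i) ha H) as [E | E];
      assert (E1 := E v1); assert (E2 := E v2); assert (E3 := E v3); assert (E4 := E v4).
    - f_equal; lra.
    - rewrite <- (cos_neg (_ / 2)), <- (cos_period (- (_ / 2)) 2); f_equal; simpl INR; lra. }
  generalize (sin2_cos2 (alpha v1 + alpha v2 + alpha v3 + alpha v4)); unfold Rsqr; intros S.
  unfold expi; rewrite Hc in *.
  replace (sin _) with 0 by nra.
  unfold Copp, RtoC; simpl; f_equal; ring.
Qed.
(** * Fixed points *)

(** As the product of the factors is [-1], the composition is [z |-> c - z]. *)
Lemma rotation_fixed_point_eq (a : quadrilateral) (alpha : vertex -> R) (i j k l : vertex) :
  (expi (alpha i) * expi (alpha j) * expi (alpha k) * expi (alpha l) = - (1))%C ->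
  rotation_fixed_point a alpha i j k l
  = (((1 - expi (alpha i)) * a i
     + expi (alpha i) * ((1 - expi (alpha j)) * a j
     + expi (alpha j) * ((1 - expi (alpha k)) * a k
     + expi (alpha k) * ((1 - expi (alpha l)) * a l)))) / RtoC 2)%C.
Proof.
  intros H; unfold rotation_fixed_point, fixed_point.
  set (c := ((1 - expi (alpha i)) * a i
     + expi (alpha i) * ((1 - expi (alpha j)) * a j
     + expi (alpha j) * ((1 - expi (alpha k)) * a k
     + expi (alpha k) * ((1 - expi (alpha l)) * a l))))%C).
  set (f := fun z => rotation (a i) (alpha i) (rotation (a j) (alpha j)
    (rotation (a k) (alpha k) (rotation (a l) (alpha l) z)))).
  change (epsilon (inhabits (RtoC 0)) (fun z => f z = z) = (c / RtoC 2)%C).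
  assert (Hf : forall z, f z = (c - z)%C).
  { intros z; transitivity (c + (expi (alpha i) * expi (alpha j) * expi (alpha k)
      * expi (alpha l)) * z)%C.
    - unfold f, rotation, c; ring.
    - rewrite H; ring. }
  assert (H2 : RtoC 2 <> 0%C) by (intros E; apply RtoC_inj in E; lra).
  assert (E2 : RtoC 2 = (1 + 1)%C) by (rewrite <- RtoC_plus; f_equal; ring).
  rewrite E2 in *.
  assert (Ec : forall z, f z = z <-> z = (c / (1 + 1))%C).
  { intros z; rewrite Hf; split.
    - intros E; replace c with (c - z + z)%C by ring.
      rewrite E; field; exact H2.
    - intros ->; field; exact H2. }
  apply Ec, (epsilon_spec (inhabits (RtoC 0)) (fun z => f z = z)).
  exists (c / (1 + 1))%C; now apply Ec.
Qed.

(** Up to a unit factor, the displacement of the fixed point when the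
    consecutive rotations about [a i] and [a j] are exchanged: the difference of
    the two compositions is the constant
    [(1 - w_i) (1 - w_j) (a i - a j)], and a fixed point is half a constant. *)
Definition half_rotated_edge (a : quadrilateral) (alpha : vertex -> R) (i j : vertex) : C :=
  ((1 - expi (alpha i)) * (1 - expi (alpha j)) * (a i - a j) / RtoC 2)%C.

Lemma swap_first_rotations (a : quadrilateral) (alpha : vertex -> R) (i j k l : vertex) :
  (expi (alpha i) * expi (alpha j) * expi (alpha k) * expi (alpha l) = - (1))%C ->
  (rotation_fixed_point a alpha i j k l - rotation_fixed_point a alpha i j l k
   = expi (alpha i) * expi (alpha j) * half_rotated_edge a alpha k l)%C.
Proof.
  intros H; rewrite !rotation_fixed_point_eq.
  - unfold half_rotated_edge, Cdiv; ring.
  - rewrite <- H; ring.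
  - exact H.
Qed.

Lemma swap_last_rotations (a : quadrilateral) (alpha : vertex -> R) (i j k l : vertex) :
  (expi (alpha i) * expi (alpha j) * expi (alpha k) * expi (alpha l) = - (1))%C ->
  (rotation_fixed_point a alpha i j k l - rotation_fixed_point a alpha j i k l
   = half_rotated_edge a alpha i j)%C.
Proof.
  intros H; rewrite !rotation_fixed_point_eq.
  - unfold half_rotated_edge, Cdiv; ring.
  - rewrite <- H; ring.
  - exact H.
Qed.

Definition swapped_quad (b : vertex -> vertex -> vertex -> vertex -> C)
    (i j k l : vertex) : quadrilateral :=
  quad (b i j k l) (b i j l k) (b j i l k) (b j i k l).

Lemma swapped_quad_parallelogram (a : quadrilateral) (alpha : vertex -> R) (i j k l : vertex) :
  (expi (alpha i) * expi (alpha j) * expi (alpha k) * expi (alpha l) = - (1))%C ->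
  parallelogram (swapped_quad (rotation_fixed_point a alpha) i j k l).
Proof.
  intros H; unfold parallelogram, swapped_quad; simpl.
  rewrite !swap_first_rotations; [ring | rewrite <- H; ring | exact H].
Qed.

Lemma unit_similarity_isometry (u p q : C) :
  Cmod u = 1 -> isometry (fun z => u * (z - p) + q)%C.
Proof.
  intros Hu z w.
  replace (u * (z - p) + q - (u * (w - p) + q))%C with (u * (z - w))%C by ring.
  rewrite Cmod_mult, Hu; ring.
Qed.

(** The isometry is [r_k r_l] followed by a translation.  It turns the sides
    [w_i w_j x] into [- x], so it shifts the numbering of the vertices by one
    step. *)
Lemma swapped_quad_congruent (a : quadrilateral) (alpha : vertex -> R) (i j k l : vertex) :
  (expi (alpha i) * expi (alpha j) * expi (alpha k) * expi (alpha l) = - (1))%C ->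
  congruent (swapped_quad (rotation_fixed_point a alpha) i j k l)
            (swapped_quad (rotation_fixed_point a alpha) k l i j).
Proof.
  intros H.
  set (b := rotation_fixed_point a alpha).
  set (u := (expi (alpha k) * expi (alpha l))%C).
  set (v := (expi (alpha i) * expi (alpha j))%C).
  assert (Huv : (u * v = - (1))%C) by (rewrite <- H; unfold u, v; ring).
  set (x := half_rotated_edge a alpha k l).
  set (y := half_rotated_edge a alpha i j).
  assert (B1 : (b i j k l - b i j l k = v * x)%C) by now apply swap_first_rotations.
  assert (B2 : (b i j k l - b j i k l = y)%C) by now apply swap_last_rotations.
  assert (B3 : (b i j l k - b j i l k = y)%C)
    by (apply swap_last_rotations; rewrite <- H; ring).
  assert (B4 : (b k l i j - b l k i j = x)%C)
    by (apply swap_last_rotations; rewrite <- H; ring).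
  assert (B5 : (b k l j i - b l k j i = x)%C)
    by (apply swap_last_rotations; rewrite <- H; ring).
  assert (B6 : (b l k i j - b l k j i = u * y)%C).
  { unfold u; rewrite (Cmult_comm (expi (alpha k))).
    apply swap_first_rotations; rewrite <- H; ring. }
  exists (fun z => u * (z - b i j k l) + b l k i j)%C, prev; split; [| split].
  - apply unit_similarity_isometry.
    unfold u; rewrite Cmod_mult, !Cmod_expi; ring.
  - left; now intros [].
  - assert (Hx : (u * (v * x) = - x)%C) by (rewrite Cmult_assoc, Huv; ring).
    intros []; simpl.
    + ring.
    + transitivity (- (u * (b i j k l - b i j l k)) + b l k i j)%C; [ring |].
      rewrite B1, Hx, <- B4; ring.
    + transitivity (- (u * (b i j k l - b i j l k)) - u * (b i j l k - b j i l k)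
        + b l k i j)%C; [ring |].
      rewrite B1, Hx, B3, <- B6, <- B5; ring.
    + transitivity (- (u * (b i j k l - b j i k l)) + b l k i j)%C; [ring |].
      rewrite B2, <- B6; ring.
Qed.

Theorem theorem1 (a : quadrilateral) (alpha : vertex -> R)
    (ha : simple_quadrilateral a)
    (halpha : forall i : vertex, is_interior_angle a i (2 * alpha i)) :
  let b := rotation_fixed_point a alpha in
  let P_e := quad (b v1 v2 v3 v4) (b v1 v2 v4 v3) (b v2 v1 v4 v3) (b v2 v1 v3 v4) in
  let P_13_24 := quad (b v3 v4 v1 v2) (b v3 v4 v2 v1) (b v4 v3 v2 v1) (b v4 v3 v1 v2) in
  let P_23 := quad (b v1 v3 v2 v4) (b v1 v3 v4 v2) (b v3 v1 v4 v2) (b v3 v1 v2 v4) in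
  let P_1342 := quad (b v2 v4 v1 v3) (b v2 v4 v3 v1) (b v4 v2 v3 v1) (b v4 v2 v1 v3) in
  let P_24 := quad (b v1 v4 v3 v2) (b v1 v4 v2 v3) (b v4 v1 v2 v3) (b v4 v1 v3 v2) in
  let P_13 := quad (b v3 v2 v1 v4) (b v3 v2 v4 v1) (b v2 v3 v4 v1) (b v2 v3 v1 v4) in
  (parallelogram P_e /\ parallelogram P_13_24 /\
   parallelogram P_23 /\ parallelogram P_1342 /\
   parallelogram P_24 /\ parallelogram P_13) /\
  (congruent P_e P_13_24 /\ congruent P_23 P_1342 /\ congruent P_24 P_13).
Proof.
  intros b P_e P_13_24 P_23 P_1342 P_24 P_13.
  assert (H : (expi (alpha v1) * expi (alpha v2) * expi (alpha v3) * expi (alpha v4) = - (1))%C).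
  { rewrite <- !expi_plus; now apply (expi_half_angle_sum a). }
  assert (par : forall i j k l,
    (expi (alpha i) * expi (alpha j) * expi (alpha k) * expi (alpha l) = - (1))%C ->
    parallelogram (swapped_quad b i j k l))
    by (intros; now apply swapped_quad_parallelogram).
  assert (con : forall i j k l,
    (expi (alpha i) * expi (alpha j) * expi (alpha k) * expi (alpha l) = - (1))%C ->
    congruent (swapped_quad b i j k l) (swapped_quad b k l i j))
    by (intros; now apply swapped_quad_congruent).
  split.
  - split; [| split; [| split; [| split; [| split]]]]; apply par; rewrite <- H; ring.
  - split; [| split]; apply con; rewrite <- H; ring.
Qed.
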